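(* Let $ABC$ be an acute-angled triangle in the Euclidean plane with orthocenter $H$. Let $A', B', C'$ be the reflections of $H$ in the lines $BC$, $CA$, $AB$, respectively. Let $X, Y, Z$ be the reflections of $A, B, C$ in the lines $B'C'$, $C'A'$, $A'B'$, respectively. Then the orthocenter of the triangle $XYZ$ is $H$.
   Context: All points lie in the Euclidean plane. The reflection (symmetric point) of a point $P$ in a line $\ell$ is the image of $P$ under orthogonal reflection across $\ell$. The orthocenter of a triangle is the common point of its three altitude lines. Speaking of ''the triangle $XYZ$'' presupposes that $X, Y, Z$ are not collinear. *)

(* Defs.v *)
From HB Require Import structures.
From mathcomp Require Import all_boot all_order all_algebra.
From mathcomp Require Import classical_sets reals trigo.

Set Implicit Arguments.
Unset Strict Implicit.
Unset Printing Implicit Defensive.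

Import Order.TTheory GRing.Theory Num.Theory.

Local Open Scope classical_set_scope.
Local Open Scope ring_scope.

(* The Euclidean plane is 'rV[R]_2 with the standard dot product. The library
   norm `|u| on matrices is the sup norm, hence the separate [enorm]. *)
Definition dot (R : realType) (u v : 'rV[R]_2) : R := (u *m v^T) 0 0.

Definition enorm (R : realType) (u : 'rV[R]_2) : R := Num.sqrt (dot u u).

(* [line P Q] is a line only when P <> Q. *)
Definition line (R : realType) (P Q : 'rV[R]_2) : set 'rV[R]_2 :=
  [set S | exists t : R, S = P + t *: (Q - P)].

Definition collinear (R : realType) (P Q S : 'rV[R]_2) : Prop :=
  exists U V : 'rV[R]_2,
    [/\ U <> V, line U V P, line U V Q & line U V S].

(* The unoriented angle PQS, with vertex Q, in [0, pi]; it is meaningful for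
   P <> Q and S <> Q. *)
Definition angle (R : realType) (P Q S : 'rV[R]_2) : R :=
  acos (dot (P - Q) (S - Q) / (enorm (P - Q) * enorm (S - Q))).

Definition acute_triangle (R : realType) (A B C : 'rV[R]_2) : Prop :=
  [/\ ~ collinear A B C,
      angle B A C < pi / 2, angle C B A < pi / 2 & angle A C B < pi / 2].

(* Orthogonal projection of P onto the line UV, for U <> V. *)
Definition foot (R : realType) (U V P : 'rV[R]_2) : 'rV[R]_2 :=
  U + (dot (P - U) (V - U) / dot (V - U) (V - U)) *: (V - U).

(* The foot is the midpoint of P and its image; meaningful for U <> V. *)
Definition reflection (R : realType) (U V P : 'rV[R]_2) : 'rV[R]_2 :=
  2 *: foot U V P - P.

(* The line through P perpendicular to the line QS, for Q <> S. *)
Definition altitude (R : realType) (P Q S : 'rV[R]_2) : set 'rV[R]_2 :=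
  [set T | dot (T - P) (S - Q) = 0].

(* H is the one and only common point of the three altitudes. *)
Definition is_orthocenter (R : realType) (A B C H : 'rV[R]_2) : Prop :=
  altitude A B C `&` altitude B C A `&` altitude C A B = [set H].

(* Main.v *)
(* Reflecting H in the sides gives AB' = AH = AC', so A is equidistant from B'
   and C' and hence X = B' + C' - A; likewise for Y and Z. With H as the
   origin, A'.B = A'.C = |A'|^2 / 2 (cyclically) and A.B = B.C = C.A; expanding
   X.(Z - Y) with these relations leaves a multiple of B.B' - C.C', and
   B.B' = 2 B.C = C.C'. *)
Require Import Defs.
From HB Require Import structures.
From mathcomp Require Import all_boot all_order all_algebra.
From mathcomp Require Import classical_sets reals trigo.
From mathcomp Require Import ring lra.

Set Implicit Arguments.
Unset Strict Implicit.
Unset Printing Implicit Defensive.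

Import Order.TTheory GRing.Theory Num.Theory.

Local Open Scope classical_set_scope.
Local Open Scope ring_scope.

Lemma dotE (R : realType) (u v : 'rV[R]_2) :
  dot u v = u 0 0 * v 0 0 + u 0 1 * v 0 1.
Proof.
by rewrite /dot mxE big_ord_recl big_ord1 !mxE;
  congr (_ + u _ _ * v _ _); apply/val_inj.
Qed.

Lemma rV2P (R : realType) (u v : 'rV[R]_2) :
  u 0 0 = v 0 0 -> u 0 1 = v 0 1 -> u = v.
Proof.
move=> e0 e1; apply/rowP => i.
by have [->|->] : i = 0 \/ i = 1;
  first by case: i => [[|[|]]] // ?; [left|right]; apply/val_inj.
Qed.

Lemma dot_eq0 (R : realType) (u : 'rV[R]_2) : dot u u = 0 -> u = 0.
Proof.
by rewrite dotE => u0; apply: rV2P; rewrite !mxE; nra.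
Qed.

Lemma reflection_dist (R : realType) (U V P : 'rV[R]_2) (t : R) :
  let S := U + t *: (V - U) in
  dot (reflection U V P - S) (reflection U V P - S) = dot (P - S) (P - S).
Proof.
move=> /=; rewrite /reflection /foot.
have [/dot_eq0 VU|n0] := eqVneq (dot (V - U) (V - U)) 0.
  (* If [U = V], the foot is [U] and the reflection is the half-turn about [U = S], which also keeps
     the distance. *)
  by rewrite VU !scaler0 !addr0 !dotE !mxE; ring.
have := divfK n0 (dot (P - U) (V - U)).
move: (_ / _) => s; rewrite !dotE !mxE => e.
(* The difference of the two squared distances is [4 * (s - t)] times the defect of [e], the
   equation that defines the foot parameter [s]. *)
have : 4 * (s - t) * (s * ((V 0 0 - U 0 0) * (V 0 0 - U 0 0)
    + (V 0 1 - U 0 1) * (V 0 1 - U 0 1))) =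
  4 * (s - t) * ((P 0 0 - U 0 0) * (V 0 0 - U 0 0)
    + (P 0 1 - U 0 1) * (V 0 1 - U 0 1)) by rewrite e.
lra.
Qed.

Lemma reflection_distl (R : realType) (U V P : 'rV[R]_2) :
  dot (reflection U V P - U) (reflection U V P - U) = dot (P - U) (P - U).
Proof. by have := reflection_dist U V P 0; rewrite /= scale0r addr0. Qed.

Lemma reflection_distr (R : realType) (U V P : 'rV[R]_2) :
  dot (reflection U V P - V) (reflection U V P - V) = dot (P - V) (P - V).
Proof. by have := reflection_dist U V P 1; rewrite /= scale1r [U + _]addrC subrK. Qed.

(** The displacement is [2 *: (U - P) + 2 * s *: (V - U)], and its second part is orthogonal to
    [Q - P] for every [s]. *)
Lemma dot_reflection (R : realType) (U V P Q : 'rV[R]_2) :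
  dot (P - Q) (V - U) = 0 ->
  dot (reflection U V P - P) (Q - P) = 2 * dot (U - P) (Q - P).
Proof.
rewrite /reflection /foot; move: (_ / _) => s; rewrite !dotE !mxE => e.
have := congr1 ( *%R (2 * s)) e; lra.
Qed.

(** The foot of the perpendicular from the apex of an isosceles triangle is the midpoint of the
    base, hence the parameter [2^-1] below. *)
Lemma reflection_equidistant (R : realType) (U V P : 'rV[R]_2) :
  dot (U - P) (U - P) = dot (V - P) (V - P) -> reflection U V P = U + V - P.
Proof.
move=> e; rewrite /reflection /foot.
have [/dot_eq0 VU|n0] := eqVneq (dot (V - U) (V - U)) 0.
  by rewrite VU scaler0 addr0 scaler_nat mulr2n -(subrK U V) VU add0r.
have -> : dot (P - U) (V - U) / dot (V - U) (V - U) = 2^-1.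
  apply: (mulIf n0); rewrite divfK //; move: e; rewrite !dotE !mxE; lra.
by apply: rV2P; rewrite !mxE; field.
Qed.

(** The vertices are listed cyclically throughout, so that rotating [A], [B], [C] turns this
    altitude of [XYZ] into the other two. *)
Lemma reflected_altitude (R : realType) (A B C H : 'rV[R]_2) :
  let A' := reflection B C H in
  let B' := reflection C A H in
  let C' := reflection A B H in
  dot (H - A) (C - B) = 0 -> dot (H - B) (A - C) = 0 ->
  dot (H - C) (B - A) = 0 ->
  dot (H - reflection B' C' A) (reflection A' B' C - reflection C' A' B) = 0.
Proof.
move=> A' B' C' hA hB hC.
have A'B := reflection_distl B C H; have A'C := reflection_distr B C H.
have B'C := reflection_distl C A H; have B'A := reflection_distr C A H.
have C'A := reflection_distl A B H; have C'B := reflection_distr A B H.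
have B'B := dot_reflection hB; have C'C := dot_reflection hC.
rewrite -/A' -/B' -/C' in A'B A'C B'C B'A C'A C'B B'B C'C.
rewrite !reflection_equidistant ?B'A ?C'B ?A'C //.
move: hA hB hC A'B A'C B'C B'A C'A C'B B'B C'C.
(* With the reflections opaque, the goal is a linear combination of the collected relations,
   products of coordinates serving as atoms. *)
clearbody A' B' C'; rewrite !dotE !mxE; lra.
Qed.

Lemma collinear_det0 (R : realType) (P Q S : 'rV[R]_2) :
  (Q 0 0 - P 0 0) * (S 0 1 - P 0 1) = (Q 0 1 - P 0 1) * (S 0 0 - P 0 0) ->
  collinear P Q S.
Proof.
move=> e.
have lineL (U V : 'rV[R]_2) : line U V U by exists 0; rewrite scale0r addr0.
have lineR (U V : 'rV[R]_2) : line U V V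
  by exists 1; rewrite scale1r [U + _]addrC subrK.
have [PQ|/eqP PQ] := eqVneq P Q.
  have [PS|/eqP PS] := eqVneq P S; last by exists P, S; rewrite -PQ; split.
  (* All three points coincide, so any second point different from [P] gives a line. *)
  exists P, (P + const_mx 1); rewrite -PQ -PS; split => // /rowP /(_ 0).
  by rewrite !mxE; lra.
exists P, Q; split => //.
have n0 : dot (Q - P) (Q - P) != 0.
  by apply/eqP => /dot_eq0 /eqP; rewrite subr_eq0 => /eqP /esym.
(* The parameter of the orthogonal projection of [S] onto the line [PQ]; the zero determinant makes
   [S] its own projection. *)
exists (dot (S - P) (Q - P) / dot (Q - P) (Q - P)).
have := divfK n0 (dot (S - P) (Q - P)).
move: (_ / _) => t; move: n0 e; rewrite !dotE !mxE => n0 e et.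
apply: rV2P; rewrite !mxE; apply: (mulIf n0).
  have := congr1 ( *%R (Q 0 1 - P 0 1)) e.
  have := congr1 ( *%R (Q 0 0 - P 0 0)) et; lra.
have := congr1 ( *%R (Q 0 0 - P 0 0)) e.
have := congr1 ( *%R (Q 0 1 - P 0 1)) et; lra.
Qed.

(** If [T] is another common point, [T - H] is orthogonal to the two independent directions [S - Q]
    and [P - S], so it vanishes. *)
Lemma orthocenter_unique (R : realType) (P Q S H : 'rV[R]_2) :
  ~ collinear P Q S ->
  altitude P Q S H -> altitude Q S P H -> altitude S P Q H ->
  is_orthocenter P Q S H.
Proof.
move=> ncol hP hQ hS; apply/seteqP; split=> [T [[tP tQ] _]|_ ->] //.
pose d := (Q 0 0 - P 0 0) * (S 0 1 - P 0 1) - (Q 0 1 - P 0 1) * (S 0 0 - P 0 0).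
have d0 : d != 0.
  by apply/eqP => /eqP; rewrite subr_eq0 => /eqP /collinear_det0.
move: hP hQ tP tQ; rewrite /altitude /= !dotE !mxE => hP hQ tP tQ.
have e1 : (T 0 0 - H 0 0) * (S 0 0 - Q 0 0) +
    (T 0 1 - H 0 1) * (S 0 1 - Q 0 1) = 0 by lra.
have e2 : (T 0 0 - H 0 0) * (P 0 0 - S 0 0) +
    (T 0 1 - H 0 1) * (P 0 1 - S 0 1) = 0 by lra.
(* Cramer's rule for [e1] and [e2]: [d] is also the determinant of [S - Q] and [P - S]. *)
apply: rV2P; apply: (mulIf d0); rewrite /d.
  have := congr1 ( *%R (P 0 1 - S 0 1)) e1.
  have := congr1 ( *%R (S 0 1 - Q 0 1)) e2; lra.
have := congr1 ( *%R (P 0 0 - S 0 0)) e1.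
have := congr1 ( *%R (S 0 0 - Q 0 0)) e2; lra.
Qed.

Theorem lemma1 (R : realType) (A B C H A' B' C' X Y Z : 'rV[R]_2)
  (hABC : acute_triangle A B C)
  (hH : is_orthocenter A B C H)
  (hA' : A' = reflection B C H)
  (hB' : B' = reflection C A H)
  (hC' : C' = reflection A B H)
  (hX : X = reflection B' C' A)
  (hY : Y = reflection C' A' B)
  (hZ : Z = reflection A' B' C)
  (hXYZ : ~ collinear X Y Z) :
  is_orthocenter X Y Z H.
Proof.
have : [set H] H by [].
rewrite -{1}hH => -[[hA hB] hC].
(* The three altitude conditions are the three cyclic instances of [reflected_altitude]. *)
by apply: orthocenter_unique => //; rewrite hX hY hZ hA' hB' hC';
  apply: reflected_altitude.
Qed.
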